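(* Let $R=K[a_1,\dots,a_n]$ be a $K$-algebra generated by $a_1,\dots,a_n$ with a two-sided admissible system $(\mathcal{B},\prec)$, where $\mathcal{B}$ is a skew multiplicative $K$-basis of $R$ and $\prec$ is a two-sided monomial ordering on $\mathcal{B}$. Suppose that, for some permutation $a_{\ell_1},\dots,a_{\ell_n}$ of $a_1,\dots,a_n$, the basis $\mathcal{B}$ contains every monomial $a_{\ell_1}^{\alpha_1}a_{\ell_2}^{\alpha_2}\cdots a_{\ell_n}^{\alpha_n}$ with $\alpha_1,\dots,\alpha_n\in\mathbb{N}$. Suppose that $\mathcal{G}=\Omega\cup G$ is a minimal Gröbner basis of the ideal $I=\langle\mathcal{G}\rangle$, where $\Omega\subset\mathcal{B}$ and $G$ consists of $\frac{n(n-1)}{2}$ elements $$g_{ji}=a_{\ell_j}a_{\ell_i}-\lambda_{ji}a_{\ell_i}a_{\ell_p},\quad 1\le i<j\le n,\ i<p\le n,\ \lambda_{ji}\in K^*\cup\{0\}$$ (where $p$ may depend on $(j,i)$), such that $\mathbf{LM}(g_{ji})=a_{\ell_j}a_{\ell_i}$ for $1\le i<j\le n$. Let $A=R/I$. Then: (i) $N(I)\subseteq\{a_{\ell_1}^{\alpha_1}a_{\ell_2}^{\alpha_2}\cdots a_{\ell_n}^{\alpha_n}\mid\alpha_1,\dots,\alpha_n\in\mathbb{N}\}$, and $\overline{N(I)}$ is a skew multiplicative $K$-basis of $A$. (ii) Let $\prec_I$ be the ordering on $\overline{N(I)}$ induced by the lexicographic ordering or by the $\mathbb{N}$-graded lexicographic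 ordering on $\mathbb{N}^n$, such that $\overline{a_{\ell_n}}\prec_I\overline{a_{\ell_{n-1}}}\prec_I\cdots\prec_I\overline{a_{\ell_2}}\prec_I\overline{a_{\ell_1}}$. If $\overline{a_{\ell_1}}^{\alpha_1}\overline{a_{\ell_2}}^{\alpha_2}\cdots\overline{a_{\ell_n}}^{\alpha_n}\ne 0$ implies $a_{\ell_1}^{\alpha_1}a_{\ell_2}^{\alpha_2}\cdots a_{\ell_n}^{\alpha_n}\in N(I)$, then $\prec_I$ is a left monomial ordering on $\overline{N(I)}$, and hence $A$ has a left Gröbner basis theory with respect to the left admissible system $(\overline{N(I)},\prec_I)$.
   Context: $K$ is a field, $K^*=K\setminus\{0\}$, $\mathbb{N}$ is the set of nonnegative integers; a $K$-algebra is a finitely generated associative $K$-algebra with identity $1$; an ideal is a two-sided ideal; $\langle S\rangle$ is the two-sided ideal generated by $S$. A skew multiplicative $K$-basis of a $K$-algebra $\Lambda$ generated by $a_1,\dots,a_n$ is a $K$-basis $\mathcal{B}$ consisting of products of powers of the generators such that for all $u,v\in\mathcal{B}$ either $uv=0$ or $uv=\lambda w$ with $\lambda\in K^*$, $w\in\mathcal{B}$. Elements of $\mathcal{B}$ are called monomials. Given a well-ordering $\prec$ on $\mathcal{B}$ and $0\ne f=\sum_{i=1}^s\lambda_iu_i$ with $\lambda_i\in K^*$, $u_i\in\mathcal{B}$, $u_1\prec\cdots\prec u_s$, put $\mathbf{LM}(f)=u_s$; also $\mathbf{LM}(0)=0$. A well-ordering $\prec$ on $\mathcal{B}$ is a two-sided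 monomial ordering if: (MO1) whenever $w,u,v,s\in\mathcal{B}$, $w\prec u$ and $\mathbf{LM}(vws),\mathbf{LM}(vus)\notin K^*\cup\{0\}$, then $\mathbf{LM}(vws)\prec\mathbf{LM}(vus)$; (MO2) for $w,u\in\mathcal{B}$, if $u=\mathbf{LM}(vws)$ for some $v,s\in\mathcal{B}$ with $v\ne1$ or $s\ne1$ (in case $1\in\mathcal{B}$), then $w\prec u$. It is a left monomial ordering if: (LMO1) whenever $w,u,v\in\mathcal{B}$, $w\prec u$ and $\mathbf{LM}(vw),\mathbf{LM}(vu)\notin K^*\cup\{0\}$, then $\mathbf{LM}(vw)\prec\mathbf{LM}(vu)$; (LMO2) for $w,u\in\mathcal{B}$, if $u=\mathbf{LM}(vw)$ for some $v\in\mathcal{B}$ with $v\ne1$ (in case $1\in\mathcal{B}$), then $w\prec u$. The pair $(\mathcal{B},\prec)$ is then a two-sided (resp. left) admissible system, and an algebra with a skew multiplicative $K$-basis having a two-sided (resp. left) admissible system is said to have a two-sided (resp. left) Gröbner basis theory. For $u,v\in\mathcal{B}$, $u\mid v$ means $v=\lambda wus$ for some $w,s\in\mathcal{B}$, $\lambda\in K^*$. For an ideal $I$ of $R$, a subset $\mathcal{G}\subset I$ of nonzero elements is a Gröbner basis of $I$ if for each nonzero $f\in I$ there is $g\in\mathcal{G}$ with $\mathbf{LM}(g)\mid\mathbf{LM}(f)$; it is minimal if no proper subset is a Gröbner basis of $I$. $N(I)=\{u\in\mathcal{B}\mid\mathbf{LM}(f)\nmid u\text{ for all }0\ne f\in I\}$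 is the set of normal monomials. For $f\in R$, $\bar f=f+I$; $\overline{N(I)}=\{\bar u\mid u\in N(I)\}$. The ordering $\prec_I$ induced by an ordering $<$ on $\mathbb{N}^n$: $\overline{a_{\ell_1}}^{\alpha_1}\cdots\overline{a_{\ell_n}}^{\alpha_n}\prec_I\overline{a_{\ell_1}}^{\beta_1}\cdots\overline{a_{\ell_n}}^{\beta_n}$ iff $\alpha<\beta$. Lexicographic (from the left): $\alpha<\beta$ iff $\alpha_i<\beta_i$ at the first index $i$ where they differ. $\mathbb{N}$-graded lexicographic: $|\alpha|<|\beta|$, or $|\alpha|=|\beta|$ and $\alpha$ is lexicographically smaller than $\beta$, where $|\alpha|=\alpha_1+\cdots+\alpha_n$. *)

(* Defs.v *)
From HB Require Import structures.
From mathcomp Require Import all_boot all_algebra.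
From mathcomp Require Import generic_quotient ring_quotient.
From mathcomp Require Import boolp classical_sets cardinality.

Set Implicit Arguments.
Unset Strict Implicit.
Unset Printing Implicit Defensive.

Import GRing.Theory.
Local Open Scope classical_set_scope.
Local Open Scope ring_scope.
Local Open Scope quotient_scope.

Section Ideals.
Variable R : pzRingType.

Definition ideal (J : {pred R}) : Prop :=
  zmod_closed J /\ (forall x y, y \in J -> x * y \in J /\ y * x \in J).

Definition ideal_gen (S : set R) : {pred R} :=
  fun x => `[< forall J : {pred R}, ideal J -> (forall s, S s -> s \in J) ->
               x \in J >].

Lemma ideal_genP S : ideal (ideal_gen S).
Proof.
split; first split.
- by apply/asboolP => J [[J0 _] _] _.
- move=> x y /asboolP xI /asboolP yI; apply/asboolP => J JI JS.
  by have [[_ JB] _] := JI; apply: JB; [exact: xI | exact: yI].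
move=> x y /asboolP yI; split; apply/asboolP => J JI JS;
  by have [_ /(_ x y (yI J JI JS)) []] := JI.
Qed.

Lemma sub_ideal_gen S s : S s -> s \in ideal_gen S.
Proof. by move=> Ss; apply/asboolP => J _; apply. Qed.

HB.instance Definition _ (S : set R) :=
  GRing.isZmodClosed.Build R (ideal_gen S) (ideal_genP S).1.

End Ideals.

(* MathComp equips {quot I} with a ring structure only for proper ideals of
   commutative rings; here I is two-sided and R / I may be zero. *)
Section Quotient.
Variables (R : pzRingType) (S : set R).
Local Notation I := (ideal_gen S).

Definition quot_ring : Type := {ideal_quot ideal_gen S}.
HB.instance Definition _ := GRing.Zmodule.on quot_ring.

Definition residue (x : R) : quot_ring :=
  \pi_({ideal_quot ideal_gen S}) x.

Lemma residue_eq x y : (residue x = residue y) <-> (x - y \in I).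
Proof. by rewrite (Quotient.idealrBE (ideal_gen S)); split=> /eqP. Qed.

Lemma residue_surj (u : quot_ring) : exists x, u = residue x.
Proof. by exists (repr u); rewrite /residue reprK. Qed.

Lemma residue_is_zmod_morphism : zmod_morphism residue.
Proof. by move=> x y; rewrite /residue raddfB. Qed.

HB.instance Definition _ :=
  GRing.isZmodMorphism.Build R quot_ring residue residue_is_zmod_morphism.

Definition quot_mul (u v : quot_ring) : quot_ring := residue (repr u * repr v).

Lemma residueM x y : residue (x * y) = quot_mul (residue x) (residue y).
Proof.
have rK z : z - repr (residue z) \in I by apply/residue_eq; rewrite /residue reprK.
apply/residue_eq; have [_ IM] := ideal_genP S.
rewrite -(subrKA (x * repr (residue y))) -mulrBr -mulrBl.
by apply: rpredD; [have [] := IM x _ (rK y) | have [] := IM (repr (residue y)) _ (rK x)].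
Qed.

Lemma quot_mulA : associative quot_mul.
Proof.
move=> u v w; have [[x ->] [y ->] [z ->]] :=
  And3 (residue_surj u) (residue_surj v) (residue_surj w).
by rewrite -!residueM mulrA.
Qed.

Lemma quot_mul1r : left_id (residue 1) quot_mul.
Proof. by move=> u; have [x ->] := residue_surj u; rewrite -residueM mul1r. Qed.

Lemma quot_mulr1 : right_id (residue 1) quot_mul.
Proof. by move=> u; have [x ->] := residue_surj u; rewrite -residueM mulr1. Qed.

Lemma quot_mulDl : left_distributive quot_mul +%R.
Proof.
move=> u v w; have [[x ->] [y ->] [z ->]] :=
  And3 (residue_surj u) (residue_surj v) (residue_surj w).
by rewrite -raddfD -!residueM mulrDl raddfD.
Qed.

Lemma quot_mulDr : right_distributive quot_mul +%R.
Proof.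
move=> u v w; have [[x ->] [y ->] [z ->]] :=
  And3 (residue_surj u) (residue_surj v) (residue_surj w).
by rewrite -raddfD -!residueM mulrDr raddfD.
Qed.

HB.instance Definition _ := GRing.Zmodule_isPzRing.Build quot_ring
  quot_mulA quot_mul1r quot_mulr1 quot_mulDl quot_mulDr.

Lemma residue_is_monoid_morphism : monoid_morphism residue.
Proof. by split=> // x y; rewrite residueM. Qed.

HB.instance Definition _ :=
  GRing.isMonoidMorphism.Build R quot_ring residue residue_is_monoid_morphism.

End Quotient.

(* MathComp's algType excludes the zero algebra, but R / I may be zero.  So a
   K-algebra is given below as a ring A with its structure map iota : K -> A;
   the scalar multiple of x by c is iota c * x.  For R : algType K, the
   structure map is in_alg R : c |-> c *: 1, and for R / I it is
   quot_alg S : c |-> residue (c *: 1). *)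
Definition quot_alg (K : fieldType) (R : algType K) (S : set R) :
  {rmorphism K -> quot_ring S} := (residue S \o in_alg R)%FUN.

Section SkewMultiplicative.
Variables (K : fieldType) (A : pzRingType) (iota : {rmorphism K -> A}).

Definition is_basis (B : set A) : Prop :=
  (forall (s : nat) (u : 'I_s -> A) (c : 'I_s -> K),
     injective u -> (forall i, B (u i)) ->
     \sum_i iota (c i) * u i = 0 -> forall i, c i = 0) /\
  (forall x, exists (s : nat) (u : 'I_s -> A) (c : 'I_s -> K),
     (forall i, B (u i)) /\ x = \sum_i iota (c i) * u i).

Definition generated_by n (a : 'I_n -> A) : Prop :=
  forall S : {pred A}, subring_closed S -> (forall c, iota c \in S) ->
    (forall i, a i \in S) -> forall x, x \in S.

Definition product_of_powers n (a : 'I_n -> A) (x : A) : Prop :=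
  exists w : seq ('I_n * nat), x = \prod_(q <- w) a q.1 ^+ q.2.

Definition skew_multiplicative_basis n (a : 'I_n -> A) (B : set A) : Prop :=
  [/\ is_basis B,
      forall u, B u -> product_of_powers a u
    & forall u v, B u -> B v -> u * v = 0 \/
        exists (c : K) (w : A), [/\ c != 0, B w & u * v = iota c * w]].

Variables (B : set A) (lt : A -> A -> Prop).

(* lt is used only through its restriction to B. *)
Definition well_ordering : Prop :=
  [/\ forall u, B u -> ~ lt u u,
      forall u v w, B u -> B v -> B w -> lt u v -> lt v w -> lt u w,
      forall u v, B u -> B v -> [\/ lt u v, u = v | lt v u]
    & forall X : set A, X `<=` B -> X !=set0 ->
        exists2 m, X m & forall x, X x -> x <> m -> lt m x].

Definition is_leading_monomial (f m : A) : Prop :=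
  exists (s : nat) (u : 'I_s.+1 -> A) (c : 'I_s.+1 -> K),
    [/\ forall i, B (u i) /\ c i != 0,
        forall i j : 'I_s.+1, (i < j)%N -> lt (u i) (u j),
        f = \sum_i iota (c i) * u i
      & m = u ord_max].

(* When B is a basis well-ordered by lt, is_leading_monomial f m holds for a
   unique m if f <> 0, and for no m if f = 0. *)
Definition LM (f : A) : A := xget 0 [set m | is_leading_monomial f m].

Definition scalar (x : A) : Prop := exists c : K, x = iota c.

Definition two_sided_monomial_ordering : Prop :=
  [/\ well_ordering,
      forall w u v s, B w -> B u -> B v -> B s -> lt w u ->
        ~ scalar (LM (v * w * s)) -> ~ scalar (LM (v * u * s)) ->
        lt (LM (v * w * s)) (LM (v * u * s))
    & forall w u v s, B w -> B u -> B v -> B s -> v <> 1 \/ s <> 1 ->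
        u = LM (v * w * s) -> lt w u].

Definition left_monomial_ordering : Prop :=
  [/\ well_ordering,
      forall w u v, B w -> B u -> B v -> lt w u ->
        ~ scalar (LM (v * w)) -> ~ scalar (LM (v * u)) ->
        lt (LM (v * w)) (LM (v * u))
    & forall w u v, B w -> B u -> B v -> v <> 1 ->
        u = LM (v * w) -> lt w u].

Definition two_sided_admissible_system n (a : 'I_n -> A) : Prop :=
  skew_multiplicative_basis a B /\ two_sided_monomial_ordering.

Definition left_admissible_system n (a : 'I_n -> A) : Prop :=
  skew_multiplicative_basis a B /\ left_monomial_ordering.

Definition divides (u v : A) : Prop :=
  exists (w s : A) (c : K), [/\ B w, B s, c != 0 & v = iota c * (w * u * s)].

Definition groebner_basis (I : {pred A}) (G : set A) : Prop :=
  (forall g, G g -> g \in I /\ g <> 0) /\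
  (forall f, f \in I -> f <> 0 -> exists2 g, G g & divides (LM g) (LM f)).

Definition minimal_groebner_basis (I : {pred A}) (G : set A) : Prop :=
  groebner_basis I G /\
  forall H, H `<=` G -> H <> G -> ~ groebner_basis I H.

Definition normal_monomials (I : {pred A}) : set A :=
  [set u | B u /\ forall f, f \in I -> f <> 0 -> ~ divides (LM f) u].

End SkewMultiplicative.

Definition left_groebner_basis_theory (K : fieldType) (A : pzRingType)
    (iota : {rmorphism K -> A}) n (a : 'I_n -> A) : Prop :=
  exists (B : set A) (lt : A -> A -> Prop), left_admissible_system iota B lt a.

(* The factors are multiplied in increasing order of i. *)
Definition ordered_monomial (A : pzRingType) n (b : 'I_n -> A)
    (alpha : 'I_n -> nat) : A :=
  \prod_(i < n) b i ^+ alpha i.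

Definition lex n (alpha beta : 'I_n -> nat) : Prop :=
  exists k : 'I_n, (forall i : 'I_n, (i < k)%N -> alpha i = beta i) /\
                   (alpha k < beta k)%N.

Definition graded_lex n (alpha beta : 'I_n -> nat) : Prop :=
  (\sum_i alpha i < \sum_i beta i)%N \/
  (\sum_i alpha i = \sum_i beta i)%N /\ lex alpha beta.

(* lt is the ordering induced on N by the ordering ltE of exponents.  If some
   element of N had two expressions b^alpha = b^beta with alpha, beta
   comparable, no lt would satisfy this: the induced ordering would not be well
   defined. *)
Definition induced_ordering (A : pzRingType) n (b : 'I_n -> A) (N : set A)
    (ltE : ('I_n -> nat) -> ('I_n -> nat) -> Prop) (lt : A -> A -> Prop) : Prop :=
  forall alpha beta,
    N (ordered_monomial b alpha) -> N (ordered_monomial b beta) ->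
    (lt (ordered_monomial b alpha) (ordered_monomial b beta) <-> ltE alpha beta).

(* Main.v *)
(* Reducing modulo the binomials g_ji sends a basis element either to 0 or to a
   scalar multiple of a smaller basis element, so by well-founded induction each
   element of B is 0 modulo I or congruent to a scalar multiple of a normal
   monomial; this makes the normal monomials a skew multiplicative basis of R / I.
   A normal monomial contains no factor a_(l j) a_(l i) with i < j, hence is an
   ordered monomial.

   For (ii), since a_j a_i = lam a_i a_(p j i) in R / I with p j i > i, moving a_j
   to the right through an ordered monomial a^alpha yields a scalar multiple of
   a^(alpha + e_q) for a position q determined by j and alpha.  Suppose alpha and
   beta first differ at k.  Their positions q depend only on the entries below k
   as long as the moving generator stops at or before k, and otherwise both are
   greater than k; so alpha |-> alpha + e_q is strictly increasing for the
   lexicographic order, and it raises the degree by one. *)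

Require Import Defs.
From HB Require Import structures.
From mathcomp Require Import all_boot all_algebra all_fingroup.
From mathcomp Require Import boolp classical_sets cardinality.

Set Implicit Arguments.
Unset Strict Implicit.
Unset Printing Implicit Defensive.

Import GRing.Theory.
Local Open Scope classical_set_scope.
Local Open Scope ring_scope.

(** * Leading monomials over a well-ordered basis *)

Section LeadingMonomials.
Variables (K : fieldType) (A : pzRingType) (iota : {rmorphism K -> A}).
Variables (B : set A) (lt : A -> A -> Prop).

(** Lists of terms, repetitions allowed, make closure under addition a concatenation. *)
Definition in_span (x : A) : Prop := exists q : seq (K * A),
  (forall y, y \in q -> B y.2) /\ x = \sum_(y <- q) iota y.1 * y.2.

Lemma in_span_scale c u : B u -> in_span (iota c * u).
Proof.
move=> Bu; exists [:: (c, u)]; split; last by rewrite big_seq1.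
by move=> y; rewrite inE => /eqP ->.
Qed.

Lemma in_span0 : in_span 0.
Proof. by exists [::]; rewrite big_nil. Qed.

Lemma in_spanD x y : in_span x -> in_span y -> in_span (x + y).
Proof.
move=> [q [Bq ->]] [r [Br ->]]; exists (q ++ r); split; last by rewrite big_cat.
by move=> z; rewrite mem_cat => /orP[/Bq|/Br].
Qed.

Lemma in_span_ord x : in_span x -> exists (s : nat) (u : 'I_s -> A) (c : 'I_s -> K),
  (forall i, B (u i)) /\ x = \sum_i iota (c i) * u i.
Proof.
move=> [q [Bq ->]]; exists (size q), (fun i => (nth (0, 0) q i).2),
  (fun i => (nth (0, 0) q i).1).
split; first by move=> i; apply/Bq/mem_nth.
by rewrite (big_nth (0, 0)) big_mkord.
Qed.

Hypothesis basisB : is_basis iota B.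

Lemma basis_free (s : seq A) (c : A -> K) :
  uniq s -> (forall x, x \in s -> B x) ->
  \sum_(x <- s) iota (c x) * x = 0 -> forall x, x \in s -> c x = 0.
Proof.
move=> us Bs; rewrite (big_nth 0) big_mkord => s0 x xs.
have := basisB.1 _ (fun i : 'I_(size s) => nth 0 s i) (fun i => c (nth 0 s i)).
have xi : (index x s < size s)%N by rewrite index_mem.
move=> /(_ _ _ s0 (Ordinal xi)) /=; rewrite nth_index //; apply.
- by move=> i j /eqP; rewrite nth_uniq // => /eqP/val_inj.
- by move=> i; apply/Bs/mem_nth.
Qed.

Lemma scaled_neq0 c u : B u -> c != 0 -> iota c * u <> 0.
Proof.
move=> Bu c0 cu0.
have := @basis_free [:: u] (fun=> c) isT _ _ u (mem_head _ _).
rewrite big_seq1 => /(_ _ cu0) H; move: c0; rewrite H ?eqxx // => x.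
by rewrite inE => /eqP ->.
Qed.

Lemma basis_neq0 u : B u -> u <> 0.
Proof.
move=> Bu; rewrite -[u]mul1r -(rmorph1 iota).
by apply: scaled_neq0; rewrite ?oner_neq0.
Qed.

(** Collecting equal terms turns a family with repetitions into one over distinct elements, to which
    [basis_free] applies. *)
Lemma sum_by_value s (u : 'I_s -> A) (c : 'I_s -> K) (r : seq A) :
  uniq r -> (forall i, u i \in r) ->
  \sum_i iota (c i) * u i =
  \sum_(x <- r) iota (\sum_(i | u i == x) c i) * x.
Proof.
move=> ur uir.
under [RHS]eq_bigr => x _ do rewrite raddf_sum mulr_suml.
under [RHS]eq_bigr => x _ do rewrite big_mkcond.
rewrite exchange_big; apply: eq_bigr => i _ /=.
rewrite (bigD1_seq (u i)) //= eqxx big1 ?addr0 // => x.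
by rewrite eq_sym => /negPf ->.
Qed.

Lemma basis_expansion x : exists (s : seq A) (c : A -> K),
  [/\ uniq s, forall y, y \in s -> B y & x = \sum_(y <- s) iota (c y) * y].
Proof.
have [s [u [c [Bu ->]]]] := basisB.2 x.
exists (undup (codom u)), (fun x => \sum_(i | u i == x) c i); split.
- exact: undup_uniq.
- by move=> y; rewrite mem_undup => /codomP[i ->].
- by apply: sum_by_value => [|i]; rewrite ?undup_uniq // mem_undup codom_f.
Qed.

Hypothesis ltB : well_ordering B lt.

(** By symmetry it is enough that the top monomial of one expansion is at most that of the other:
    its coefficient is nonzero, so it must also occur in the other expansion. *)
Lemma leading_monomial_uniq f m m' :
  is_leading_monomial iota B lt f m -> is_leading_monomial iota B lt f m' -> m = m'.
Proof.
have [irr tr tot _] := ltB.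
have half s (u : 'I_s.+1 -> A) c t (v : 'I_t.+1 -> A) d :
    (forall i, B (u i) /\ c i != 0) ->
    (forall i j : 'I_s.+1, (i < j)%N -> lt (u i) (u j)) ->
    (forall i, B (v i) /\ d i != 0) ->
    (forall i j : 'I_t.+1, (i < j)%N -> lt (v i) (v j)) ->
    \sum_i iota (c i) * u i = \sum_i iota (d i) * v i ->
    u ord_max = v ord_max \/ lt (u ord_max) (v ord_max).
  move=> Bu lu Bv lv.
  have uinj i j : u i = u j -> i = j.
    move=> uij; have [/lu|/lu|/val_inj//] := ltngtP i j; rewrite uij => luu.
      by have := irr _ (Bu j).1 luu.
    by have := irr _ (Bu j).1 luu.
  pose r := undup (codom u ++ codom v).
  rewrite (@sum_by_value _ u c r) ?undup_uniq //; last first.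
    by move=> i; rewrite mem_undup mem_cat codom_f.
  rewrite (@sum_by_value _ v d r) ?undup_uniq //; last first.
    by move=> i; rewrite mem_undup mem_cat codom_f orbT.
  move=> /eqP; rewrite -subr_eq0 -sumrB => /eqP.
  under eq_bigr => x _ do rewrite -mulrBl -raddfB.
  move=> /(basis_free (c := fun x => _ - _) (undup_uniq _)) H.
  have Br x : x \in r -> B x.
    rewrite mem_undup mem_cat => /orP[] /codomP[i ->]; first by have [] := Bu i.
    by have [] := Bv i.
  have {}H := H Br (u ord_max).
  (* If no [v j] were equal to [u ord_max], its coefficient in the difference would be [c ord_max],
     which is nonzero. *)
  have [j ej] : exists j, v j = u ord_max.
    apply: contrapT => nj; have := H; rewrite mem_undup mem_cat codom_f => /(_ isT)/eqP.
    rewrite [X in _ - X]big_pred0 => [|j]; last first.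
      by apply/eqP => ej; apply: nj; exists j.
    rewrite subr0 (bigD1 ord_max) //= big1 ?addr0 => [|i /andP[/eqP/uinj ->]].
      by apply/negP; have [] := Bu ord_max.
    by rewrite eqxx.
  rewrite -ej; have := leq_ord j; rewrite leq_eqVlt => /orP[/eqP jm|jm].
    by left; congr v; apply: val_inj.
  by right; apply: lv.
move=> [s [u [c [Bu lu -> ->]]]] [t [v [d [Bv lv e ->]]]].
have [//|h1] := half _ _ _ _ _ _ Bu lu Bv lv e.
have [//|h2] := half _ _ _ _ _ _ Bv lv Bu lu (esym e).
have Bum := (Bu ord_max).1; have Bvm := (Bv ord_max).1.
by have := irr _ Bum (tr _ _ _ Bum Bvm Bum h1 h2).
Qed.

Lemma LM_eq f m : is_leading_monomial iota B lt f m -> LM iota B lt f = m.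
Proof. by move=> fm; apply: xget_unique => // m' /leading_monomial_uniq; apply. Qed.

Lemma LM_scaled c w : c != 0 -> B w -> LM iota B lt (iota c * w) = w.
Proof.
move=> c0 Bw; apply: LM_eq; exists 0, (fun=> w), (fun=> c); split => //.
  by move=> i j; rewrite !ord1.
by rewrite big_ord1.
Qed.

Lemma LM_basis w : B w -> LM iota B lt w = w.
Proof. by move=> Bw; rewrite -{1}[w]mul1r -(rmorph1 iota) LM_scaled ?oner_neq0. Qed.

(** An expansion giving 0 a leading monomial would be a nontrivial relation, so [xget] returns its
    default 0. *)
Lemma LM0 : LM iota B lt 0 = 0.
Proof.
apply: xgetPN => m [s [u [c [Bu lu e em]]]].
have [irr _ _ _] := ltB.
have := basisB.1 _ u c _ (fun i => (Bu i).1) (esym e) ord_max.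
have [_ /eqP c0] := Bu ord_max => /(_ _)/c0; apply => i j uij.
have [/lu|/lu|/val_inj//] := ltngtP i j; rewrite uij => luu.
  by have := irr _ (Bu j).1 luu.
by have := irr _ (Bu j).1 luu.
Qed.

Lemma leading_monomial_exists f (s : seq A) (c : A -> K) :
  uniq s -> (forall x, x \in s -> B x) ->
  f = \sum_(x <- s) iota (c x) * x -> f <> 0 ->
  exists2 m, m \in s & is_leading_monomial iota B lt f m.
Proof.
have [irr tr tot _] := ltB.
move=> us Bs ef f0.
(* Terms with zero coefficient are dropped and the rest sorted. The order is total and transitive
   only on [B], hence the predicate [P]. *)
pose r x y := `[< lt x y \/ x = y >].
pose s1 := [seq x <- s | c x != 0]; pose s2 := sort r s1.
have s2s x : (x \in s2) = (c x != 0) && (x \in s) by rewrite mem_sort mem_filter.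
have us2 : uniq s2 by rewrite sort_uniq filter_uniq.
pose P := [pred x | `[< B x >]].
have Ps2 : all P s2 by apply/allP => x; rewrite s2s => /andP[_ /Bs] /asboolP.
have rtot : {in P &, total r}.
  move=> x y /asboolP Bx /asboolP By; have [?|?|?] := tot x y Bx By.
  - by apply/orP; left; apply/asboolP; left.
  - by apply/orP; left; apply/asboolP; right.
  - by apply/orP; right; apply/asboolP; left.
have rtr : {in P & &, transitive r}.
  move=> y x z /asboolP By /asboolP Bx /asboolP Bz /asboolP[xy|->] // /asboolP[yz|<-];
    apply/asboolP; left => //; exact: tr xy yz.
have s2_lt i j : (j < size s2)%N -> (i < j)%N -> lt (nth 0 s2 i) (nth 0 s2 j).
  move=> js ij; have is2 := ltn_trans ij js.
  have : sorted r s2.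
    by apply: (sort_sorted_in rtot); rewrite -(perm_all _ (permEl (perm_sort r s1))).
  move=> /(sorted_ltn_nth_in rtr 0 Ps2)/(_ _ _ is2 js ij)/asboolP[//|/eqP].
  by rewrite nth_uniq // => /eqP e; rewrite e ltnn in ij.
have ef2 : f = \sum_(x <- s2) iota (c x) * x.
  rewrite (perm_big _ (permEl (perm_sort r s1))) big_filter ef.
  rewrite (bigID (fun x => c x != 0)) /= [X in _ + X]big1 ?addr0 // => x.
  by rewrite negbK => /eqP ->; rewrite rmorph0 mul0r.
case sz : (size s2) => [|k].
  by case: f0; rewrite ef2; move/size0nil: sz => ->; rewrite big_nil.
have s2k (i : 'I_k.+1) : nth 0 s2 i \in s2 by rewrite mem_nth // sz.
exists (nth 0 s2 k); first by have := s2k ord_max; rewrite s2s => /andP[].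
exists k, (fun i : 'I_k.+1 => nth 0 s2 i), (fun i : 'I_k.+1 => c (nth 0 s2 i)); split => //.
- by move=> i; have := s2k i; rewrite s2s => /andP[? /Bs].
- by move=> i j; apply: s2_lt; rewrite sz.
- by rewrite ef2 (big_nth 0) big_mkord sz.
Qed.

(** Ensures that a nonzero combination of normal monomials has a normal leading monomial. *)
Lemma LM_support s (u : 'I_s -> A) (c : 'I_s -> K) :
  (forall i, B (u i)) -> \sum_i iota (c i) * u i <> 0 ->
  exists i, LM iota B lt (\sum_i iota (c i) * u i) = u i.
Proof.
move=> Bu f0; have ur i : u i \in undup (codom u) by rewrite mem_undup codom_f.
have [|m] := leading_monomial_exists (undup_uniq _) _ (sum_by_value c (undup_uniq _) ur) f0.
  by move=> x; rewrite mem_undup => /codomP[i ->].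
by rewrite mem_undup => /codomP[i ->] /LM_eq; exists i.
Qed.

Lemma LM_leading f : f <> 0 -> is_leading_monomial iota B lt f (LM iota B lt f).
Proof.
move=> f0; have [s [c [us Bs ef]]] := basis_expansion f.
have [m _ fm] := leading_monomial_exists us Bs ef f0.
by rewrite (LM_eq fm).
Qed.

Lemma LM_in f : f <> 0 -> B (LM iota B lt f).
Proof. by move=> /LM_leading[s [u [c [Bu _ _ ->]]]]; case: (Bu ord_max). Qed.

Lemma LM_binomial_lt m w c : B w -> m - iota c * w <> 0 ->
  LM iota B lt (m - iota c * w) = m -> [\/ c = 0, w = m | lt w m].
Proof.
move=> Bw f0 em; have Bm : B m by rewrite -em; apply: LM_in.
have [irr tr tot _] := ltB.
have [->|c0] := eqVneq c 0; first by constructor 1.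
have [wm|->|mw] := tot _ _ Bw Bm; [by constructor 3|by constructor 2|].
(* When [m] precedes [w], the terms [m], [w] form an increasing expansion of the binomial, so its
   leading monomial is [w]. *)
constructor 2; rewrite -em; apply/esym/LM_eq.
exists 1, (fun i : 'I_2 => if i == ord_max then w else m),
  (fun i : 'I_2 => if i == ord_max then - c else 1); split.
- by move=> i; case: ifP => _; rewrite ?oppr_eq0 ?oner_neq0.
- by case=> [[|[|?]]] //= ?; case=> [[|[|?]]] //=.
- by rewrite !big_ord_recl big_ord0 /= rmorph1 mul1r addr0 raddfN mulNr.
- by rewrite eqxx.
Qed.

Lemma well_ordering_ind (P : A -> Prop) :
  (forall u, B u -> (forall w, B w -> lt w u -> P w) -> P u) ->
  forall u, B u -> P u.
Proof.
have [irr tr tot wf] := ltB.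
move=> IH u Bu; apply: contrapT => nPu.
have [|m [Bm nPm] minm] := wf [set x | B x /\ ~ P x] (fun x h => h.1).
  by exists u.
apply/nPm/IH => // w Bw wm; apply: contrapT => nPw.
have [e|ne] := pselect (w = m); first by rewrite e in wm; apply: irr wm.
by apply: irr (tr _ _ _ Bm Bw Bm (minm _ _ ne) wm).
Qed.

End LeadingMonomials.

(* big_enum does not apply: multiplication is not commutative. *)
Lemma ordered_monomial_enum (A : pzRingType) n (b : 'I_n -> A) alpha :
  \prod_(i <- enum 'I_n) b i ^+ alpha i = ordered_monomial b alpha.
Proof. by rewrite /ordered_monomial [index_enum _]unlock enumT. Qed.

(** * Orders on exponent vectors and insertion of a generator *)

Section ExponentOrders.
Variable n : nat.
Implicit Types (alpha beta : 'I_n -> nat) (i j : 'I_n).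

Lemma lex_irr alpha : ~ lex alpha alpha.
Proof. by move=> [k [_]]; rewrite ltnn. Qed.

Lemma lex_trans beta alpha gamma : lex alpha beta -> lex beta gamma -> lex alpha gamma.
Proof.
move=> [k [ek lk]] [m [em lm]]; have [km|mk|/val_inj e] := ltngtP k m.
- exists k; split; last by rewrite -em.
  by move=> i ik; rewrite ek // em // (ltn_trans ik).
- exists m; split; last by rewrite ek.
  by move=> i im; rewrite ek ?em // (ltn_trans im).
- subst m; exists k; split; last exact: ltn_trans lk lm.
  by move=> i ik; rewrite ek // em.
Qed.

Lemma argmin_nat (T : Type) (f : T -> nat) (X : set T) : X !=set0 ->
  exists2 m, X m & forall x, X x -> (f m <= f x)%N.
Proof.
move=> [x0 Xx0].
have [|k /asboolP[m [Xm <-]] mink] := @ex_minnP (fun k : nat => `[< exists x, X x /\ f x = k >]).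
  by exists (f x0); apply/asboolP; exists x0.
by exists m => // x Xx; apply: mink; apply/asboolP; exists x.
Qed.

Definition has_least (T : Type) (r : T -> T -> Prop) : Prop :=
  forall X : set T, X !=set0 -> exists2 m, X m & forall x, X x -> x <> m -> r m x.

Lemma lex_least : has_least (@lex n).
Proof.
move=> X X0.
(* Induction on the number [k] of coordinates already minimised. *)
suff: forall k : nat, (k <= n)%N -> exists2 m, X m & forall x, X x ->
    (forall i, (i < k)%N -> x i = m i) \/
    exists q : 'I_n, [/\ (q < k)%N, forall i, (i < q)%N -> m i = x i & (m q < x q)%N].
  move=> /(_ n (leqnn n))[m Xm minm]; exists m => // x Xx xm.
  have [e|[q [_ eq lq]]] := minm x Xx; last by exists q.
  by case: xm; apply/funext => i; apply: e.
elim=> [_|k IH kn]; first by have [m Xm] := X0; exists m => // x _; left.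
have [m Xm minm] := IH (ltnW kn); pose kk := Ordinal kn.
(* Among the elements agreeing with [m] below [k], one with least entry at [k] is chosen. *)
have [|m' [Xm' em'] minm'] := argmin_nat (fun x : 'I_n -> nat => x kk)
  (X := [set x | X x /\ forall i, (i < k)%N -> x i = m i]); first by exists m.
exists m' => // x Xx; have [e|[q [qk eq lq]]] := minm x Xx; last first.
  right; exists q; split; [exact: ltnW|move=> i iq|].
    by rewrite em' ?eq // (ltn_trans iq).
  by rewrite em'.
have := minm' x (conj Xx e); rewrite leq_eqVlt => /orP[/eqP ek|lk].
  left=> i; rewrite ltnS leq_eqVlt => /orP[/eqP ik|ik]; last by rewrite e ?em'.
  by have -> : i = kk by apply: val_inj.
by right; exists kk; split => // i ik; rewrite em' ?e.
Qed.

Lemma graded_lex_irr alpha : ~ graded_lex alpha alpha.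
Proof. by move=> [|[_ /lex_irr]//]; rewrite ltnn. Qed.

Lemma graded_lex_trans beta alpha gamma :
  graded_lex alpha beta -> graded_lex beta gamma -> graded_lex alpha gamma.
Proof.
move=> [lab|[eab lab]] [lbg|[ebg lbg]].
- by left; apply: ltn_trans lab lbg.
- by left; rewrite -ebg.
- by left; rewrite eab.
- by right; rewrite eab; split=> //; apply: lex_trans lab lbg.
Qed.

Lemma graded_lex_least : has_least (@graded_lex n).
Proof.
move=> X /(argmin_nat (fun x : 'I_n -> nat => \sum_i x i)%N)[m0 Xm0 min0].
have [|m [Xm em] minm] := @lex_least [set x | X x /\ \sum_i x i = \sum_i m0 i]%N.
  by exists m0.
exists m => // x Xx xm; have := min0 x Xx; rewrite leq_eqVlt => /orP[/eqP e|l].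
  by right; rewrite em e; split=> //; apply: minm.
by left; rewrite em.
Qed.

(* T j alpha is the exponent of the ordered monomial proportional to
   b_j * b^alpha. *)
Record left_compatible (T : 'I_n -> ('I_n -> nat) -> ('I_n -> nat))
    (ltE : ('I_n -> nat) -> ('I_n -> nat) -> Prop) : Prop := LeftCompatible {
  lc_irr : forall alpha, ~ ltE alpha alpha;
  lc_trans : forall beta alpha gamma, ltE alpha beta -> ltE beta gamma -> ltE alpha gamma;
  lc_least : has_least ltE;
  lc_mono : forall j alpha beta, ltE alpha beta -> ltE (T j alpha) (T j beta);
  lc_incr : forall j alpha, ltE alpha (T j alpha) }.

Definition incr (q : 'I_n) alpha : 'I_n -> nat := fun i => (alpha i + (i == q))%N.

Lemma incr_id q alpha : incr q alpha q = (alpha q).+1.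
Proof. by rewrite /incr eqxx addn1. Qed.

Lemma incr_lt (q i : 'I_n) alpha : (i < q)%N -> incr q alpha i = alpha i.
Proof. by move=> iq; rewrite /incr -val_eqE ltn_eqF ?addn0. Qed.

Lemma incr_gt (q i : 'I_n) alpha : (q < i)%N -> incr q alpha i = alpha i.
Proof. by move=> qi; rewrite /incr -val_eqE gtn_eqF ?addn0. Qed.

Lemma sum_incr q alpha : (\sum_i incr q alpha i = (\sum_i alpha i).+1)%N.
Proof.
by rewrite big_split /= -[X in (_ + X)%N]big_mkcond /= big_pred1_eq addn1.
Qed.

Lemma lex_incr q alpha : lex alpha (incr q alpha).
Proof.
by exists q; rewrite incr_id ltnSn; split=> // i /incr_lt ->.
Qed.

Variable p : 'I_n -> 'I_n -> 'I_n.
Hypothesis p_gt : forall i j, (i < j)%N -> (i < p j i)%N.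

(* Moving b_j to the right past b_i replaces it by b_(p j i). *)
Definition step i j : 'I_n := if (i < j)%N then p j i else j.

(** The index of the power that absorbs [b_j] as it moves right through the powers listed in [s]. On
    a final segment containing [j], the test [j <= i] first succeeds when [i] equals the current
    index. *)
Fixpoint landing (s : seq 'I_n) alpha j : 'I_n :=
  if s is i :: s' then
    if (j <= i)%N then j else landing s' alpha (iter (alpha i) (step i) j)
  else j.

Definition insert j alpha := incr (landing (enum 'I_n) alpha j) alpha.

Lemma iter_step_gt i j e : (i < j)%N -> (i < iter e (step i) j)%N.
Proof. by move=> ij; elim: e => //= e IH; rewrite /step IH p_gt. Qed.

(* s is a final segment of 'I_n, listed in increasing order. *)
Fixpoint final_segment (s : seq 'I_n) : Prop :=
  if s is i :: s' then (forall j, (i < j)%N = (j \in s')) /\ final_segment s'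
  else True.

Lemma final_segment_enum : final_segment (enum 'I_n).
Proof.
(* Here [iota] is the list of consecutive naturals: the values of [s] run from [k] to [n - 1]. *)
suff: forall (k : nat) s, map val s = iota k (n - k) -> final_segment s.
  by move=> /(_ 0%N (enum 'I_n)); apply; rewrite val_enum_ord subn0.
move=> k s; elim: s k => //= i s IH k.
case nk : (n - k)%N => [//|m] /= [ik es].
have nk' : (n - k.+1 = m)%N by rewrite subnS nk.
split; last by apply: (IH k.+1); rewrite nk'.
move=> j; rewrite -(mem_map val_inj) es mem_iota ik -nk' subnKC ?ltn_ord ?andbT //.
by rewrite -subn_gt0 nk.
Qed.

(** The moving index may drop when it passes [b_i], but by [p_gt] it stays above [i], so it never
    returns to a position already passed. *)
Lemma landing_gt s alpha i j : final_segment (i :: s) -> (i < j)%N ->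
  (i < landing s alpha j)%N.
Proof.
elim: s i j => //= k s IH i j [si [sk fs]] ij.
case: (leqP j k) => [//|kj]; apply: (@ltn_trans k).
  by rewrite si mem_head.
by apply: IH => //; apply: iter_step_gt.
Qed.

(** Below [k] both passages meet equal entries, hence carry the same index. They stop together, or
    reach [k] with the same index and then both stop there or both go beyond. *)
Lemma landing_lex s alpha beta j k : final_segment s -> k \in s -> j \in s ->
  (forall i, (i < k)%N -> alpha i = beta i) ->
  landing s alpha j = landing s beta j \/
  (k < landing s alpha j)%N /\ (k < landing s beta j)%N.
Proof.
move=> + + + eab; elim: s j => // i s IH j /= [si fs]; rewrite !inE.
move=> /orP[/eqP ->|ks] js.
  case: (leqP j i) => ij; first by left.
  by right; split; apply: (@landing_gt s _ i) => //; apply: iter_step_gt.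
case: (leqP j i) => ij; first by left.
by rewrite eab ?si //; apply: IH => //; rewrite -si; apply: iter_step_gt.
Qed.

Lemma insert_lex j alpha beta : lex alpha beta -> lex (insert j alpha) (insert j beta).
Proof.
move=> [k [ek lk]].
(* In the first case the same unit vector is added to both sides; in the second the entries up to
   [k] do not change. *)
have [e|[ka kb]] := landing_lex final_segment_enum (mem_enum _ k) (mem_enum _ j) ek.
  exists k; rewrite /insert /incr -e ltn_add2r; split=> // i ik.
  by rewrite ek.
exists k; rewrite /insert; split=> [i ik|]; last by rewrite !incr_lt.
by rewrite !incr_lt ?ek // (ltn_trans ik).
Qed.

Lemma insert_lex_compatible : left_compatible insert (@lex n).
Proof.
split; [exact: lex_irr|exact: lex_trans|exact: lex_least|exact: insert_lex|].
by move=> j alpha; apply: lex_incr.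
Qed.

Lemma insert_graded_lex_compatible : left_compatible insert (@graded_lex n).
Proof.
split; [exact: graded_lex_irr|exact: graded_lex_trans|exact: graded_lex_least| |].
  move=> j alpha beta [l|[e l]]; [left|right]; rewrite !sum_incr //.
  by rewrite e; split=> //; apply: insert_lex.
by move=> j alpha; left; rewrite sum_incr.
Qed.

(** * Straightening products by the binomial relations *)

Section Straightening.
Variables (K : fieldType) (A : pzRingType) (iota : {rmorphism K -> A}).
Variables (b : 'I_n -> A) (lam : 'I_n -> 'I_n -> K).
Hypothesis iotaC : forall c x, iota c * x = x * iota c.
Hypothesis straighten : forall i j, (i < j)%N ->
  b j * b i = iota (lam j i) * (b i * b (p j i)).

(** The scalar may be 0, since [lam] may vanish; the formula thus also covers products that are
    zero. *)
Lemma straighten_power i j e : (i < j)%N ->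
  exists c, b j * b i ^+ e = iota c * (b i ^+ e * b (iter e (step i) j)).
Proof.
move=> ij; elim: e => [|e [c IH]]; first by exists 1; rewrite rmorph1 !mul1r mulr1.
have ij' := iter_step_gt e ij.
have -> : iter e.+1 (step i) j = p (iter e (step i) j) i by rewrite iterS {1}/step ij'.
exists (c * lam (iter e (step i) j) i).
rewrite exprSr mulrA IH -!mulrA straighten // rmorphM -!mulrA; congr (_ * _).
by rewrite !mulrA iotaC.
Qed.

Lemma straighten_segment s alpha j : final_segment s -> j \in s ->
  exists c, b j * (\prod_(i <- s) b i ^+ alpha i) =
    iota c * \prod_(i <- s) b i ^+ incr (landing s alpha j) alpha i.
Proof.
elim: s j => // i s IH j /= fs; have [si fs'] := fs; rewrite inE => js.
(* Raising an exponent at a position up to [i] leaves the product over the later indices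
   unchanged. *)
have tl (q : 'I_n) : (q <= i)%N ->
    \prod_(k <- s) b k ^+ incr q alpha k = \prod_(k <- s) b k ^+ alpha k.
  move=> qi; apply: eq_big_seq => k; rewrite -si => ik.
  by rewrite incr_gt //; apply: leq_ltn_trans ik.
rewrite !big_cons; case: (leqP j i) => ij.
  (* [j] is in [i :: s] but not beyond [i], so [b_j] merges with the power of [b_i]. *)
  have -> : j = i.
    by case/orP: js => [/eqP//|]; rewrite -si ltnNge ij.
  by exists 1; rewrite rmorph1 mul1r tl // incr_id exprS mulrA.
have [c1 e1] := straighten_power (alpha i) ij.
have ij' := iter_step_gt (alpha i) ij.
have [|c2 e2] := IH (iter (alpha i) (step i) j) fs'; first by rewrite -si.
exists (c1 * c2); rewrite mulrA e1 -!mulrA e2 rmorphM -!mulrA; congr (_ * _).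
rewrite mulrA -iotaC -mulrA; congr (_ * (_ * _)).
by rewrite incr_lt //; apply: landing_gt.
Qed.

(** Letters are inserted starting from the rightmost. This describes left multiplication by any
    ordered monomial, once that monomial is spelled as a word. *)
Lemma straighten_word (ws : seq 'I_n) alpha : exists c,
  (\prod_(j <- ws) b j) * ordered_monomial b alpha =
  iota c * ordered_monomial b (foldr insert alpha ws).
Proof.
elim: ws => [|j ws [c IH]] /=; first by exists 1; rewrite big_nil rmorph1.
have [c' IH'] := straighten_segment (foldr insert alpha ws) final_segment_enum (mem_enum _ j).
exists (c * c'); rewrite big_cons -mulrA IH mulrA -iotaC -mulrA rmorphM -mulrA.
by congr (_ * _); rewrite -!ordered_monomial_enum IH'.
Qed.

End Straightening.
End ExponentOrders.

(** * Words in the generators *)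

Section Words.
Variables (A : pzRingType) (n : nat) (b : 'I_n -> A).

Lemma product_of_powers_word x :
  product_of_powers b x -> exists ws : seq 'I_n, x = \prod_(i <- ws) b i.
Proof.
move=> [w ->]; elim: w => [|[i e] w [ws IH]]; first by exists [::]; rewrite !big_nil.
exists (nseq e i ++ ws); rewrite big_cons big_cat /= IH; congr (_ * _).
by elim: e {IH} => [|e IHe]; rewrite ?big_nil //= exprS big_cons IHe.
Qed.

Lemma ordered_monomial_word alpha :
  exists ws : seq 'I_n, ordered_monomial b alpha = \prod_(i <- ws) b i.
Proof.
apply: product_of_powers_word; exists [seq (i, alpha i) | i <- enum 'I_n].
by rewrite big_map /= ordered_monomial_enum.
Qed.

Lemma ordered_monomial0 : ordered_monomial b (fun=> 0%N) = 1.
Proof. by rewrite /ordered_monomial big1. Qed.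

(** The powers before position [j] are trivial, so [b_j] joins its own power without any commutation
    relation. *)
Lemma mul_ordered_monomial (j : 'I_n) alpha : (forall k : 'I_n, (k < j)%N -> alpha k = 0%N) ->
  b j * ordered_monomial b alpha = ordered_monomial b (incr j alpha).
Proof.
move=> aj; rewrite -!ordered_monomial_enum.
elim: (enum 'I_n) (final_segment_enum n) (mem_enum xpredT j) => //= i s IH [si fs].
rewrite !inE !big_cons => js; have [ij|ji] := ltnP i j.
  rewrite incr_lt // aj // !expr0 !mul1r IH //.
  by rewrite -si.
have ij : i = j by move: js; rewrite -si ltnNge ji orbF => /eqP.
subst i; rewrite mulrA -exprS incr_id; congr (_ * _).
by apply: eq_big_seq => k; rewrite -si => /incr_gt ->.
Qed.

Lemma ordered_monomial_gen (j : 'I_n) :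
  b j = ordered_monomial b (incr j (fun=> 0%N)).
Proof. by rewrite -mul_ordered_monomial // ordered_monomial0 mulr1. Qed.

Lemma sorted_word (ws : seq 'I_n) : sorted (fun i j : 'I_n => i <= j)%N ws ->
  \prod_(i <- ws) b i = ordered_monomial b (fun k => count_mem k ws).
Proof.
elim: ws => [|j ws IH] js; first by rewrite big_nil ordered_monomial0.
rewrite big_cons IH ?(path_sorted js) // mul_ordered_monomial.
  congr ordered_monomial; apply/funext => k.
  by rewrite /incr /= addnC eq_sym.
move=> k kj; apply/count_memPn/negP => kws.
have tr : transitive (fun i j : 'I_n => i <= j)%N by move=> ? ? ?; apply: leq_trans.
by move: (allP (order_path_min tr js) k kws); rewrite leqNgt kj.
Qed.

(** A descent is the leading monomial of some [g j i], which rules it out in the word of a normal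
    monomial. *)
Lemma sorted_or_descent (ws : seq 'I_n) : sorted (fun i j : 'I_n => i <= j)%N ws \/
  exists w1 j i w2, ws = w1 ++ j :: i :: w2 /\ (i < j)%N.
Proof.
elim: ws => [|j [|i ws] IH]; [by left|by left|].
case: (leqP j i) => ij; last by right; exists [::], j, i, ws.
case: IH => [s|[w1 [j' [i' [w2 [-> lt']]]]]]; first by left; rewrite /= ij.
by right; exists (j :: w1), j', i', w2.
Qed.

End Words.

(** * Orderings induced from exponents *)

Section InducedOrdering.
Variables (K : fieldType) (A : pzRingType) (iota : {rmorphism K -> A}).
Variables (n : nat) (b : 'I_n -> A) (N : set A).
Variables (T : 'I_n -> ('I_n -> nat) -> ('I_n -> nat)).
Variables (ltE : ('I_n -> nat) -> ('I_n -> nat) -> Prop) (lt : A -> A -> Prop).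
Hypothesis basisN : is_basis iota N.
Hypothesis N_ordered : forall u, N u -> exists alpha, u = ordered_monomial b alpha.
Hypothesis ordered_N :
  forall alpha, ordered_monomial b alpha <> 0 -> N (ordered_monomial b alpha).
Hypothesis mul_word : forall (ws : seq 'I_n) alpha, exists c,
  (\prod_(j <- ws) b j) * ordered_monomial b alpha =
  iota c * ordered_monomial b (foldr T alpha ws).
Hypothesis T_compat : left_compatible T ltE.
Hypothesis ltE_lt : induced_ordering b N ltE lt.

Lemma induced_well_ordering : well_ordering N lt.
Proof.
have [irrE trE wfE _ _] := T_compat.
have wf (X : set A) : X `<=` N -> X !=set0 ->
    exists2 m, X m & forall x, X x -> x <> m -> lt m x.
  move=> XN [x Xx]; have [al xal] := N_ordered (XN _ Xx).
  (* All exponents expressing elements of [X] compete; a least one yields the least element. *)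
  have [|m Xm minm] := wfE [set be | X (ordered_monomial b be)].
    by exists al; rewrite /= -xal.
  exists (ordered_monomial b m) => // y Xy ym.
  have [be ybe] := N_ordered (XN _ Xy); rewrite ybe in Xy ym *.
  apply/ltE_lt; [exact: XN|exact: XN|apply: minm => // e].
  by rewrite e in ym.
split => //.
- by move=> u /[dup] /N_ordered[al ->] Nu; rewrite ltE_lt.
- move=> u v w /[dup] /N_ordered[al ->] Nu /[dup] /N_ordered[be ->] Nv.
  by move=> /[dup] /N_ordered[ga ->] Nw; rewrite !ltE_lt //; apply: trE.
(* Totality of [ltE] is not assumed: comparability comes from the least element of the pair. *)
- move=> u v Nu Nv; have [||m um minm] := wf [set x | x = u \/ x = v].
  + by move=> x [->|->].
  + by exists u; left.
  have [->|uv] := pselect (u = v); first by constructor 2.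
  case: um => e; rewrite e in minm.
    by constructor 1; apply: minm; [right|apply/nesym].
  by constructor 3; apply: minm => //; left.
Qed.

Lemma foldr_mono (ws : seq 'I_n) alpha beta :
  ltE alpha beta -> ltE (foldr T alpha ws) (foldr T beta ws).
Proof. by move=> ab; elim: ws => //= j ws; apply: (lc_mono T_compat). Qed.

Lemma foldr_incr (ws : seq 'I_n) alpha : ws <> [::] -> ltE alpha (foldr T alpha ws).
Proof.
elim: ws => //= j [_ _|i ws IH _]; first exact: (lc_incr T_compat).
by apply: (lc_trans T_compat) (IH _) (lc_incr T_compat _ _).
Qed.

(** A nonzero product forces the ordered monomial on the right to be nonzero, and [ordered_N] then
    places it in [N]. *)
Lemma LM_mul_word (ws : seq 'I_n) alpha :
  let f := (\prod_(j <- ws) b j) * ordered_monomial b alpha in f <> 0 ->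
  N (ordered_monomial b (foldr T alpha ws)) /\
  LM iota N lt f = ordered_monomial b (foldr T alpha ws).
Proof.
move=> f; have [c ef] := mul_word ws alpha; rewrite {}/f ef => f0.
have Nf : N (ordered_monomial b (foldr T alpha ws)).
  by apply: ordered_N => e; rewrite e mulr0 in f0.
split=> //; apply: LM_scaled => //; first exact: induced_well_ordering.
by apply/eqP => c0; rewrite c0 rmorph0 mul0r in f0.
Qed.

Lemma induced_left_monomial_ordering : left_monomial_ordering iota N lt.
Proof.
have wN := induced_well_ordering.
(* The leading monomial of 0 is 0, which is the scalar [iota 0]. *)
have scalar0 (f : A) : ~ Defs.scalar iota (LM iota N lt f) -> f <> 0.
  by move=> + f0; rewrite f0 LM0 //; apply; exists 0; rewrite rmorph0.
split=> //.
- move=> w u v /[dup] /N_ordered[al ->] Nw /[dup] /N_ordered[be ->] Nu.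
  move=> /N_ordered[ga ->]; have [ws ->] := ordered_monomial_word b ga.
  move=> /(ltE_lt Nw Nu) ab /scalar0/LM_mul_word[N1 ->] /scalar0/LM_mul_word[N2 ->].
  by apply/ltE_lt => //; apply: foldr_mono.
- move=> w u v /[dup] /N_ordered[al ->] Nw Nu.
  move=> /N_ordered[ga ->]; have [ws ->] := ordered_monomial_word b ga => ws1 eu.
  (* [u] is a basis element, hence nonzero, so it cannot be the leading monomial of 0. *)
  have : (\prod_(i <- ws) b i) * ordered_monomial b al <> 0.
    by move=> e; apply: (basis_neq0 basisN Nu); rewrite eu e LM0.
  move=> /LM_mul_word[N1 e]; rewrite {}eu {}e; apply/ltE_lt => //.
  by apply: foldr_incr => e; apply: ws1; rewrite e big_nil.
Qed.

End InducedOrdering.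

Lemma in_alg_mul (K : fieldType) (R : algType K) (c : K) (x : R) :
  (in_alg R : {rmorphism K -> R}) c * x = c *: x.
Proof. exact: mulr_algl. Qed.

(** * Reduction modulo binomials and the basis of the quotient *)

Section BinomialQuotient.
Variables (K : fieldType) (R : algType K) (n : nat) (a : 'I_n -> R).
Variables (B : set R) (lt : R -> R -> Prop) (S : set R).
Local Notation iota := (in_alg R : {rmorphism K -> R}).
Local Notation I := (ideal_gen S).
Local Notation LM := (LM iota B lt).
Local Notation N := (normal_monomials iota B lt I).
Local Notation bar := (residue S).

Lemma quot_algC (c : K) (x : quot_ring S) : quot_alg S c * x = x * quot_alg S c.
Proof.
have [y ->] := residue_surj x.
by rewrite /quot_alg /= -!rmorphM mulr_algl mulr_algr.
Qed.

Lemma residue_mul (x y : R) : bar (x * y) = bar x * bar y.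
Proof. exact: residueM. Qed.

Lemma residue_scale (c : K) (x : R) : bar (iota c * x) = quot_alg S c * bar x.
Proof. by rewrite rmorphM. Qed.

Lemma residue_ordered_monomial m (b : 'I_m -> R) alpha :
  bar (ordered_monomial b alpha) = ordered_monomial (fun i => bar (b i)) alpha.
Proof. by rewrite rmorph_prod; apply: eq_bigr => i _; rewrite rmorphXn. Qed.

Lemma residue_sum s (c : 'I_s -> K) (u : 'I_s -> R) :
  bar (\sum_i iota (c i) * u i) = \sum_i quot_alg S (c i) * bar (u i).
Proof. by rewrite raddf_sum; apply: eq_bigr => i _; apply: residue_scale. Qed.

Lemma residue0 : bar 0 = 0.
Proof. exact: raddf0. Qed.

Lemma residue_in_ideal (x : R) : x \in I -> bar x = 0.
Proof. by move=> xI; rewrite -(raddf0 bar); apply/residue_eq; rewrite subr0. Qed.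

Hypothesis adm : two_sided_admissible_system iota B lt a.
Hypothesis B1 : B 1.

Let skewB := adm.1.
Let basisB : is_basis iota B. Proof. by have [] := skewB. Qed.
Let ltB : well_ordering B lt. Proof. by have [] := adm.2. Qed.

(** With 1 in [B], the non-scalar conditions on a monomial ordering amount to differing from 1. *)
Lemma scalar_basis u : B u -> Defs.scalar iota u -> u = 1.
Proof.
move=> Bu [c eu]; have c0 : c != 0.
  by apply/eqP => c0; apply: (basis_neq0 basisB Bu); rewrite eu c0 rmorph0.
by rewrite -(LM_basis basisB ltB Bu) eu -[iota c]mulr1 LM_scaled.
Qed.

Lemma one_least u : B u -> u = 1 \/ lt 1 u.
Proof.
move=> Bu; have [->|u1] := pselect (u = 1); [by left|right].
have [_ _ mo2] := adm.2; apply: (mo2 1 u u 1) => //; first by left.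
by rewrite !mulr1 LM_basis.
Qed.

(** Monotonicity needs both products non-scalar. Since 1 is at most [w], [w] precedes [m] and [m] is
    at most [u], the monomial [u] lies above 1; the case [u' = 1] is then immediate. *)
Lemma lt_sandwich x w m y (c d : K) u u' :
  B x -> B w -> B m -> B y -> B u -> B u' -> lt w m -> c != 0 -> d != 0 ->
  x * m * y = iota c * u -> x * w * y = iota d * u' -> lt u' u.
Proof.
move=> Bx Bw Bm By Bu Bu' wm c0 d0 eu eu'.
have [irr tr tot _] := ltB; have [_ mo1 mo2] := adm.2.
have LMu : LM (x * m * y) = u by rewrite eu LM_scaled.
have LMu' : LM (x * w * y) = u' by rewrite eu' LM_scaled.
have wu : lt w u.
  have [/not_orP[/contrapT x1 /contrapT y1]|xy] := pselect (~ (x <> 1 \/ y <> 1)).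
    by rewrite -LMu x1 y1 mul1r mulr1 LM_basis.
  by apply: tr wm _ => //; apply: (mo2 m u x y) => //; apply: contrapT.
have lt1u : lt 1 u.
  by have [e|lt1w] := one_least Bw; [rewrite -e|apply: tr lt1w wu].
have [->//|lt1u'] := one_least Bu'.
rewrite -LMu -LMu'; apply: mo1 => //.
- rewrite LMu' => /(scalar_basis Bu') e; rewrite e in lt1u'.
  exact: irr lt1u'.
- rewrite LMu => /(scalar_basis Bu) e; rewrite e in lt1u.
  exact: irr lt1u.
Qed.

(** Products of cofactors are scaled basis elements or 0, and 0 is excluded because [w] is
    nonzero. *)
Lemma divides_trans u v w : B w ->
  divides iota B u v -> divides iota B v w -> divides iota B u w.
Proof.
move=> Bw [x [y [c [Bx By c0 ->]]]] [x' [y' [c' [Bx' By' c'0 ew]]]].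
have {}ew : w = iota (c' * c) * ((x' * x) * u * (y * y')).
  by rewrite ew !in_alg_mul -scalerAr -scalerAl scalerA !mulrA.
have w0 := basis_neq0 basisB Bw.
have [_ _ mulB] := skewB.
have [e|[d [z [d0 Bz ez]]]] := mulB _ _ Bx' Bx; first by rewrite ew e !mul0r mulr0 in w0.
have [e|[d' [z' [d'0 Bz' ez']]]] := mulB _ _ By By'; first by rewrite ew e !mulr0 in w0.
exists z, z', (c' * c * d * d'); split; rewrite ?mulf_neq0 //.
rewrite ew ez ez' !in_alg_mul -!scalerAr -!scalerAl !scalerA; congr (_ *: _).
by rewrite mulrAC.
Qed.

Hypothesis gbS : groebner_basis iota B lt I S.
Hypothesis binomialS : forall g, S g ->
  exists (c : K) (w : R), B w /\ g = LM g - iota c * w.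

Lemma normal_form u : B u -> bar u = 0 \/
  exists (c : K) (v : R), [/\ c != 0, N v & bar u = quot_alg S c * bar v].
Proof.
elim/(well_ordering_ind ltB) => {}u Bu IH.
have [Nu|nNu] := pselect (N u).
  by right; exists 1, u; rewrite rmorph1 mul1r oner_neq0.
have [f [fI f0 fu]] : exists f, [/\ f \in I, f <> 0 & divides iota B (LM f) u].
  apply: contrapT => nf; apply: nNu; split=> // f fI f0 fu.
  by apply: nf; exists f.
(* The Gröbner basis property replaces [f] by a [g] in [S], whose binomial form permits a reduction
   step. *)
have [g Sg gf] := gbS.2 f fI f0.
have [gI g0] := gbS.1 g Sg.
have [x [y [c [Bx By c0 eu]]]] := divides_trans Bu gf fu.
have [d [w [Bw eg]]] := binomialS Sg.
have Bm := LM_in basisB ltB g0; set m := LM g in eu eg Bm.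
have barm : bar m = quot_alg S d * bar w.
  apply/eqP; rewrite -subr_eq0 -residue_scale -raddfB -eg.
  exact/eqP/residue_in_ideal.
have baru : bar u = quot_alg S (c * d) * bar (x * w * y).
  rewrite eu residue_scale !residue_mul barm rmorphM -!mulrA; congr (_ * _).
  by rewrite !mulrA -quot_algC.
have [d0|d0] := eqVneq d 0; first by left; rewrite baru d0 mulr0 rmorph0 mul0r.
pose P x := bar x = 0 \/
  exists (e : K) (v : R), [/\ e != 0, N v & bar x = quot_alg S e * bar v].
have Pscale e x1 x2 : e != 0 -> bar x1 = quot_alg S e * bar x2 -> P x2 -> P x1.
  move=> e0 ex [z|[e' [v [e'0 Nv ev]]]]; first by left; rewrite ex z mulr0.
  right; exists (e * e'), v; split=> //; first by rewrite mulf_neq0.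
  by rewrite ex ev mulrA -rmorphM.
apply: (Pscale _ _ _ _ baru); first by rewrite mulf_neq0.
have [_ _ mulB] := skewB.
have [dz|wm|wm] : [\/ d = 0, w = m | lt w m].
  have em : LM g = m by [].
  clearbody m; rewrite eg in g0 em.
  by have := LM_binomial_lt basisB ltB Bw g0 em.
- by rewrite dz eqxx in d0.
(* Here [g] is [1 - d] times [m], with [1 - d] invertible because [g] is nonzero; so [m] itself lies
   in the ideal. *)
- have d1 : 1 - d != 0.
    apply/eqP => /subr0_eq d1; apply: g0.
    by rewrite eg wm -d1 rmorph1 mul1r subrr.
  have bm0 : bar m = 0.
    have -> : m = iota (1 - d)^-1 * g.
      rewrite eg wm !in_alg_mul -{2}[m]scale1r -scalerBl scalerA mulVf //.
      by rewrite scale1r.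
    by rewrite residue_scale (residue_in_ideal gI) mulr0.
  by left; rewrite wm !residue_mul bm0 mulr0 mul0r.
have [e|[d1 [z [d10 Bz ez]]]] := mulB _ _ Bx Bw; first by left; rewrite e mul0r residue0.
have [e|[d2 [z' [d20 Bz' ez']]]] := mulB _ _ Bz By.
  by left; rewrite ez -mulrA e mulr0 residue0.
have exy : x * w * y = iota (d1 * d2) * z'.
  by rewrite ez !in_alg_mul -scalerAl ez' in_alg_mul scalerA.
have zu : lt z' u.
  (* As [u] is [c] times [x * m * y], that product is [c^-1] times [u]. *)
  apply: (@lt_sandwich x w m y c^-1 (d1 * d2)) => //; rewrite ?invr_eq0 ?mulf_neq0 //.
  by rewrite eu !in_alg_mul scalerA mulVf // scale1r.
apply: (Pscale (d1 * d2) _ z'); [by rewrite mulf_neq0| |exact: IH].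
by rewrite exy residue_scale.
Qed.

(** A nonzero combination in the ideal would have one of the [u i] as leading monomial,
    contradicting the normality of that [u i]. *)
Lemma normal_free s (u : 'I_s -> R) (c : 'I_s -> K) :
  injective u -> (forall i, N (u i)) ->
  \sum_i iota (c i) * u i \in I -> forall i, c i = 0.
Proof.
move=> uinj Nu fI; have Bu i : B (u i) by have [] := Nu i.
have [f0|f0] := pselect (\sum_i iota (c i) * u i = 0); first exact: basisB.1 f0.
have [i ei] := LM_support basisB ltB Bu f0.
have [_ /(_ _ fI f0)[]] := Nu i; rewrite ei.
by exists 1, 1, 1; rewrite oner_neq0 rmorph1 !mul1r mulr1.
Qed.

Lemma quotient_skew_basis :
  skew_multiplicative_basis (quot_alg S) (fun i => bar (a i)) (bar @` N).
Proof.
have [_ prodB mulB] := skewB; split; first split.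
(* Distinct residues have distinct lifts, so a relation lifts to a combination of distinct normal
   monomials lying in the ideal. *)
- move=> s u c uinj Nu e.
  have H : forall i, exists x, N x /\ bar x = u i.
    by move=> i; have [x Nx xu] := Nu i; exists x.
  have [v Nv] := boolp.choice H.
  apply: (@normal_free s v c) => [i j vij|i|].
  + by apply: uinj; rewrite -(Nv i).2 -(Nv j).2 vij.
  + exact: (Nv i).1.
  + rewrite -[X in X \in _]subr0; apply/residue_eq; rewrite residue0 residue_sum -[RHS]e.
    by apply: eq_bigr => i _; rewrite (Nv i).2.
- move=> x; apply: in_span_ord; have [y ->] := residue_surj x.
  have [s [u [c [Bu ->]]]] := basisB.2 y; rewrite residue_sum.
  apply: big_ind => [|x1 x2|i _]; [exact: in_span0|exact: in_spanD|].
  have [->|[d [v [d0 Nv ->]]]] := normal_form (Bu i).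
    by rewrite mulr0; apply: in_span0.
  by rewrite mulrA -rmorphM; apply: in_span_scale; exists v.
- move=> _ [u [Bu _] <-]; have [w ->] := prodB u Bu; exists w.
  by rewrite rmorph_prod; apply: eq_bigr => q _; rewrite rmorphXn.
- move=> _ _ [u [Bu _] <-] [v [Bv _] <-]; rewrite -residue_mul.
  have [->|[c [w [c0 Bw ->]]]] := mulB _ _ Bu Bv; first by left; rewrite residue0.
  rewrite residue_scale; have [->|[d [x [d0 Nx ->]]]] := normal_form Bw.
    by left; rewrite mulr0.
  right; exists (c * d), (bar x); rewrite mulf_neq0 // mulrA -rmorphM; split=> //.
Qed.

Lemma word_scaled m (b : 'I_m -> R) (ws : seq 'I_m) : (forall i, B (b i)) ->
  \prod_(i <- ws) b i = 0 \/
  exists (c : K) (w : R), [/\ c != 0, B w & \prod_(i <- ws) b i = iota c * w].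
Proof.
move=> Bb; have [_ _ mulB] := skewB; elim: ws => [|j ws [IH|[c [w [c0 Bw IH]]]]].
- by right; exists 1, 1; rewrite oner_neq0 big_nil rmorph1 mul1r.
- by left; rewrite big_cons IH mulr0.
rewrite big_cons IH in_alg_mul -scalerAr.
have [->|[d [x [d0 Bx ->]]]] := mulB _ _ (Bb j) Bw; first by left; rewrite scaler0.
by right; exists (c * d), x; rewrite mulf_neq0 // !in_alg_mul scalerA.
Qed.

(** The flanking words need not lie in [B]: each is a scaled basis element, the value 0 being
    excluded since [u] is nonzero. *)
Lemma divides_word m (b : 'I_m -> R) (w1 w2 : seq 'I_m) x u :
  (forall i, B (b i)) -> B u ->
  u = \prod_(i <- w1) b i * x * \prod_(i <- w2) b i -> divides iota B x u.
Proof.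
move=> Bb Bu eu; have u0 := basis_neq0 basisB Bu.
have [e|[c [y [c0 By ey]]]] := word_scaled w1 Bb; first by rewrite eu e !mul0r in u0.
have [e|[d [z [d0 Bz ez]]]] := word_scaled w2 Bb; first by rewrite eu e mulr0 in u0.
exists y, z, (c * d); rewrite mulf_neq0 //; split=> //.
by rewrite eu ey ez !in_alg_mul -scalerAr -!scalerAl scalerA mulrC.
Qed.

End BinomialQuotient.

(** * Assembly of both parts of the theorem *)

Theorem theorem2p2 (K : fieldType) (R : algType K) (n : nat) (a : 'I_n -> R)
    (a_gen : generated_by (in_alg R) a)
    (B : set R) (lt : R -> R -> Prop)
    (adm : two_sided_admissible_system (in_alg R) B lt a)
    (l : {perm 'I_n})
    (B_ordered : forall alpha : 'I_n -> nat,
       B (ordered_monomial (fun i => a (l i)) alpha))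
    (p : 'I_n -> 'I_n -> 'I_n) (lam : 'I_n -> 'I_n -> K)
    (g : 'I_n -> 'I_n -> R)
    (p_gt : forall i j : 'I_n, (i < j)%N -> (i < p j i)%N)
    (gE : forall i j : 'I_n, (i < j)%N ->
       g j i = a (l j) * a (l i) - lam j i *: (a (l i) * a (l (p j i))))
    (LMg : forall i j : 'I_n, (i < j)%N ->
       LM (in_alg R) B lt (g j i) = a (l j) * a (l i))
    (Omega G : set R)
    (Omega_B : Omega `<=` B)
    (GE : G = [set x | exists i j : 'I_n, (i < j)%N /\ x = g j i])
    (G_card : (G #= `I_((n * n.-1) %/ 2)%N)%card)
    (minGB : minimal_groebner_basis (in_alg R) B lt
               (ideal_gen (Omega `|` G)) (Omega `|` G)) :
  let S := Omega `|` G in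
  let I := ideal_gen S in
  let bar := residue S : R -> quot_ring S in
  let abar := fun i => bar (a i) in
  let abarl := fun i => abar (l i) in
  let N := normal_monomials (in_alg R) B lt I in
  let Nbar := bar @` N in
  (* (i) *)
  (N `<=` [set u | exists alpha : 'I_n -> nat,
             u = ordered_monomial (fun i => a (l i)) alpha] /\
   skew_multiplicative_basis (quot_alg S) abar Nbar) /\
  (* (ii) *)
  (forall ltI : quot_ring S -> quot_ring S -> Prop,
     induced_ordering abarl Nbar (@lex n) ltI \/
     induced_ordering abarl Nbar (@graded_lex n) ltI ->
     (forall i j : 'I_n, j = i.+1 :> nat -> ltI (abarl j) (abarl i)) ->
     (forall alpha : 'I_n -> nat, ordered_monomial abarl alpha <> 0 ->
        N (ordered_monomial (fun i => a (l i)) alpha)) ->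
     left_monomial_ordering (quot_alg S) Nbar ltI /\
     left_admissible_system (quot_alg S) Nbar ltI abar /\
     left_groebner_basis_theory (quot_alg S) abar).

Proof.
move=> S I bar abar abarl N Nbar.
pose b i := a (l i).
have B1 : B 1 by rewrite -(ordered_monomial0 b); apply: B_ordered.
have Bb i : B (b i) by rewrite ordered_monomial_gen; apply: B_ordered.
(* Applied to the second term of [g j i], whose factors are in order by [p_gt]. *)
have Bbb (i j : 'I_n) : (i < j)%N -> B (b i * b j).
  move=> ij; rewrite [b j]ordered_monomial_gen mul_ordered_monomial; first exact: B_ordered.
  by move=> k ki; rewrite incr_lt // (ltn_trans ki).
have basisB : is_basis (in_alg R) B by have [[]] := adm.
have ltB : well_ordering B lt by have [_ []] := adm.
have gbS := minGB.1.
have Sg (i j : 'I_n) : (i < j)%N -> S (g j i).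
  by move=> ij; right; rewrite GE; exists i, j.
have binomialS x : S x -> exists (c : K) (w : R),
    B w /\ x = LM (in_alg R) B lt x - in_alg R c * w.
  (* An element of [Omega] counts as a binomial with coefficient 0 and [w = 1]. *)
  case=> [/Omega_B Bx|]; first by exists 0, 1; rewrite LM_basis // rmorph0 mul0r subr0.
  rewrite GE => -[i [j [ij ->]]]; exists (lam j i), (b i * b (p j i)).
  split; first exact/Bbb/p_gt.
  by rewrite LMg // {1}gE // in_alg_mul.
have N_ordered : N `<=` [set u | exists alpha, u = ordered_monomial b alpha].
  move=> u [Bu normu].
  have [[_ /(_ u Bu)/product_of_powers_word[ws eu] _] _] := adm.
  (* The word is respelled in the permuted generators [b]. *)
  have {ws}[ws {}eu] : exists ws : seq 'I_n, u = \prod_(i <- ws) b i.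
    exists [seq (l^-1)%g i | i <- ws]; rewrite big_map eu.
    by apply: eq_bigr => i _; rewrite /b permKV.
  have [/(sorted_word b) e|[w1 [j [i [w2 [ews ij]]]]]] := sorted_or_descent ws.
    by exists (fun k => count_mem k ws); rewrite eu e.
  (* At a descent, [u] would be divisible by the leading monomial of [g j i], an element of the
     ideal. *)
  have [gI g0] := gbS.1 _ (Sg _ _ ij).
  case: (normu _ gI g0); rewrite LMg //.
  apply: (divides_word adm B1 (w1 := w1) (w2 := w2)) => //.
  by rewrite eu ews big_cat !big_cons /= !mulrA.
have skewN : skew_multiplicative_basis (quot_alg S) abar Nbar.
  exact: (quotient_skew_basis adm B1 gbS binomialS).
split=> // ltI ltIE _ ordered_N.
have [basisN _ _] := skewN.
have Nbar_ordered u : Nbar u -> exists alpha, u = ordered_monomial abarl alpha.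
  by move=> [v /N_ordered[al ->] <-]; exists al; apply: residue_ordered_monomial.
have ordered_Nbar al :
    ordered_monomial abarl al <> 0 -> Nbar (ordered_monomial abarl al).
  move=> /ordered_N Nal; exists (ordered_monomial b al) => //.
  exact: residue_ordered_monomial.
(* In the quotient [g j i] becomes 0, which is this commutation relation. *)
have straighten (i j : 'I_n) : (i < j)%N ->
    abarl j * abarl i = quot_alg S (lam j i) * (abarl i * abarl (p j i)).
  move=> ij; rewrite -[LHS]residue_mul -[X in _ = _ * X]residue_mul.
  rewrite -[RHS]residue_scale; apply/residue_eq.
  by rewrite in_alg_mul -gE //; apply/sub_ideal_gen/Sg.
have mul_word := straighten_word p_gt (@quot_algC _ _ S) straighten.
have leftN : left_monomial_ordering (quot_alg S) Nbar ltI.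
  case: ltIE; apply: (induced_left_monomial_ordering basisN Nbar_ordered ordered_Nbar mul_word).
    exact: insert_lex_compatible.
  exact: insert_graded_lex_compatible.
by split=> //; split=> //; exists Nbar, ltI.
Qed.
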